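(* Let $M_{1,1}$ be equipped with the pointwise convergence topology. There is a comeager subset $A\subset M_{1,1}$ such that for each $\boldsymbol f=(f_n)\in A$ the following hold: (1) $\boldsymbol f\in M_1^s$, i.e. $f_n\to0$ $P$-almost surely; (2) the set $\{x\in K:\ \limsup_{n\to\infty} f_n(x)=+\infty \text{ and } \liminf_{n\to\infty} f_n(x)=-\infty\}$ is a dense $G_\delta$ subset of $K$.
   Context: Setting: $(\Omega,\Sigma,P)$ is a probability space and $(\Sigma_n)_{n\in\mathbb N}$ is a filtration of finite $\sigma$-algebras, i.e. an increasing sequence of finite $\sigma$-subalgebras of $\Sigma$. For each $n$, $\mathcal D_n$ is the finite partition of $\Omega$ (into nonempty sets) generating $\Sigma_n$; thus $\mathcal D_m$ refines $\mathcal D_n$ for $m\ge n$. Standing assumptions: (1) $P(D)>0$ for each $n\in\mathbb N$ and $D\in\mathcal D_n$; (2) for each $n\in\mathbb N$ and $D\in\mathcal D_n$ there is $m>n$ with $D\notin\mathcal D_m$. The space $K$: $K=\{(D_n)\in\prod_{n\in\mathbb N}\mathcal D_n : D_m\subset D_n \text{ for } m\ge n\}$, with the topology inherited from the product, each $\mathcal D_n$ being discrete (a metrizable compact space). Martingales: a martingale (adapted to $(\Sigma_n)$) is a sequence $\boldsymbol f=(f_n)$ with $f_n\in L^1(\Omega,\Sigma_n,P|_{\Sigma_n})$ and $\int_E f_n\,dP=\int_E f_m\,dP$ whenever $n\le m$ and $E\in\Sigma_n$. Each $f_n$ is constant on each $D\in\mathcal D_n$; that value is denoted $f_n(D)$.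 For $x=(D_k)_{k}\in K$ we write $f_n(x)=f_n(D_n)$. Spaces: $M_1$ is the space of all martingales adapted to $(\Sigma_n)$ with $\|\boldsymbol f\|_1=\sup_n\|f_n\|_{L^1}<\infty$; $M_1^s$ is the subspace of $M_1$ of martingales with $f_n\to0$ $P$-almost surely on $\Omega$; $M_{1,1}=\{\boldsymbol f\in M_1:\|\boldsymbol f\|_1\le1\}$. The pointwise convergence topology on $M_{1,1}$ is the topology inherited from the product $\prod_{n\in\mathbb N}L^1(\Omega,\Sigma_n,P|_{\Sigma_n})$ (each factor with its norm topology). *)

(* Defs.v *)
From HB Require Import structures.
From mathcomp Require Import all_boot all_order all_algebra.
From mathcomp Require Import all_classical all_reals all_analysis measurable_realfun.

Set Implicit Arguments.
Unset Strict Implicit.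
Unset Printing Implicit Defensive.

Import Order.TTheory GRing.Theory Num.Theory.
Import numFieldNormedType.Exports.

Local Open Scope classical_set_scope.
Local Open Scope ring_scope.

Section Baire_category.
Context {X : topologicalType}.
Implicit Type A : set X.

Definition nowhere_dense A := (closure A)° = set0.

Definition meager A :=
  exists2 F : (set X)^nat, (forall i, nowhere_dense (F i)) & A = \bigcup_i F i.

Definition comeager A := meager (~` A).

End Baire_category.

(* [LfunType] comes without a topology, so the topology of the L^1-norm is put
   on an alias. Elements are functions, not classes modulo equality almost
   everywhere, so this is a pseudometric; it separates points on the subspaces
   [L1_sub P S] below as soon as all nonempty members of the finite
   sigma-algebra [S] have positive probability. *)
Section L1.
Context {d : measure_display} {T : measurableType d} {R : realType}.
Variable P : probability T R.

Definition L1 : Type := LfunType P (@lexx _ _ 1%E).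

Definition L1_fun (f : L1) : T -> R := f.
Coercion L1_fun : L1 >-> Funclass.

Definition L1_ball (f : L1) (e : R) (g : L1) : Prop :=
  ('N[P]_1[EFin \o (f \- g)%R] < e%:E)%E.

Lemma L1_ball_center (f : L1) (e : R) : 0 < e -> L1_ball f e f.
Proof.
move=> e0; rewrite /L1_ball.
under eq_Lnorm do rewrite /= subrr.
by rewrite -[X in Lnorm _ _ X]/(cst 0%E) Lnorm0// lte_fin.
Qed.

Lemma L1_ball_sym (f g : L1) (e : R) : L1_ball f e g -> L1_ball g e f.
Proof.
rewrite /L1_ball -oppe_Lnorm => fg.
by under eq_Lnorm do rewrite /= -opprB EFinN.
Qed.

Lemma L1_ball_triangle (f g h : L1) (e1 e2 : R) :
  L1_ball f e1 g -> L1_ball g e2 h -> L1_ball f (e1 + e2) h.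
Proof.
rewrite /L1_ball => fg gh; rewrite EFinD.
have -> : 'N[P]_1[EFin \o (f \- h)%R]%E =
    'N[P]_1[(EFin \o (f \- g)%R) \+ (EFin \o (g \- h)%R)]%E.
  by apply: eq_Lnorm => x /=; rewrite -EFinD addrA subrK.
apply: le_lt_trans (lteD fg gh); exact: eminkowski.
Qed.

HB.instance Definition _ := Choice.on L1.

HB.instance Definition _ := hasNbhs.Build L1 (nbhs_ (entourage_ L1_ball)).

HB.instance Definition _ := Nbhs_isPseudoMetric.Build R L1 erefl
  L1_ball_center L1_ball_sym L1_ball_triangle erefl.

(* L^1(T, S, P|_S) as the subspace of the S-measurable functions in
   L^1(T, P), for a sub-sigma-algebra S *)
Definition L1_sub (S : set (set T)) : set L1 :=
  [set f | measurable_fun [set: g_sigma_algebraType S] f].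

End L1.

Arguments L1 {d T R}.
Arguments L1_sub {d T R}.

Section martingales.
Context {d : measure_display} {T : measurableType d} {R : realType}.
Variables (P : probability T R) (Sigma : nat -> set (set T)).

Definition adapted : topologicalType :=
  prod_topology (fun n => set_type (L1_sub P (Sigma n))).

Definition mfun_at (f : adapted) (n : nat) : T -> R := set_val (f n).

Definition martingale : set adapted :=
  [set f | forall n m E, (n <= m)%N -> Sigma n E ->
    (\int[P]_(w in E) (mfun_at f n w)%:E =
     \int[P]_(w in E) (mfun_at f m w)%:E)%E].

Definition martingale_norm (f : adapted) : \bar R :=
  ereal_sup (range (fun n => 'N[P]_1[EFin \o mfun_at f n]%E)).

Definition M1 : set adapted :=
  [set f | martingale f /\ (martingale_norm f < +oo)%E].

Definition M1s : set adapted :=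
  [set f | M1 f /\ {ae P, forall w, mfun_at f n w @[n --> \oo] --> (0 : R)}].

Definition M11 : set adapted :=
  [set f | M1 f /\ (martingale_norm f <= 1)%E].

End martingales.

Arguments martingale {d T R} P Sigma _.
Arguments M1 {d T R} P Sigma _.
Arguments M1s {d T R} P Sigma _.
Arguments M11 {d T R} P Sigma _.

Section branches.
Context {T : pointedType}.
Variable D : nat -> set (set T).

Definition branches :
    set (prod_topology (fun n => discrete_topology (set_type (D n)))) :=
  [set x | forall n m, (n <= m)%N ->
    (set_val (x m) : set T) `<=` (set_val (x n) : set T)].

Definition branch_at (x : branches) (n : nat) : set T :=
  set_val (set_val x n).

End branches.

Arguments branches {T} D _.

(* the value on [B] of a function that is constant on the nonempty set [B] *)
Definition value_on {T : Type} {R : realType} (f : T -> R) (B : set T) : R :=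
  get [set y | f @` B = [set y]].

Definition value_at_branch {d : measure_display} {T : measurableType d}
    {R : realType} (P : probability T R) (Sigma D : nat -> set (set T))
    (f : adapted P Sigma) (x : branches D) (n : nat) : R :=
  value_on (mfun_at f n) (branch_at x n).

Definition finite_filtration {d : measure_display} {T : measurableType d}
    (Sigma : nat -> set (set T)) : Prop :=
  [/\ forall n, sigma_algebra [set: T] (Sigma n),
      forall n, finite_set (Sigma n),
      forall n, Sigma n `<=` measurable
    & forall n m, (n <= m)%N -> Sigma n `<=` Sigma m].

Definition generating_partitions {T : Type} (Sigma D : nat -> set (set T)) :=
  forall n, [/\ finite_set (D n), partition (D n) id [set: T]
              & Sigma n = <<s D n >>].

(* Main.v *)
Require Import Defs.
From HB Require Import structures.
From mathcomp Require Import all_boot all_order all_algebra.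
From mathcomp Require Import all_classical all_reals all_analysis borel_hierarchy.
From mathcomp Require Import ring lra.

Set Implicit Arguments.
Unset Strict Implicit.
Unset Printing Implicit Defensive.

Import Order.TTheory GRing.Theory Num.Theory.
Import numFieldNormedType.Exports.

Local Open Scope classical_set_scope.
Local Open Scope ring_scope.

(** The set of good martingales is the intersection over [j] of the sets
    [oscillating_concentrated j] of those [f] for which, at some time [m >= j],
    the function [f m] exceeds [j] and goes below [- j] in every atom of level
    [j], while the integral of its absolute value over some set of probability
    less than [4^-1 ^+ j] is greater than [1 - 4^-1 ^+ j].

    Each of these sets is open, as it is defined by finitely many strict
    inequalities at a fixed time. Each is dense: a neighbourhood in the pointwise
    topology constrains finitely many coordinates only, so [f] may be shrunk a
    little, stopped at a late time, and continued by moving, inside each atom,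
    the positive part and the negative part of its mass onto two disjoint atoms
    of much later level and tiny probability; the norm that is left, up to [1],
    is spent on equal and opposite amounts on these two atoms
    ([concentrated_density], [oscillating_concentrated_approx]). Arbitrarily
    small atoms exist inside every atom because every atom is eventually split.

    Let [f] belong to all of them. The unit ball leaves no room for mass outside
    the small set: there the integral of the absolute value stays below
    [4^-1 ^+ j] at all later times. A localized maximal inequality
    ([maximal_inequality]) and the Borel-Cantelli lemma then give convergence to
    [0] almost surely ([concentrated_cvg0]). As for the branches, the large
    values found in every atom are chained into a nested sequence of atoms
    starting from any given atom, hence density ([oscillates_beyond_dense]); the
    set is a G_delta because the value at a fixed time depends continuously on
    the branch.

    Measurability and conditioning are handled through the finite partitions: a
    set is measurable at time [n] when it is a union of atoms, a function when it
    is constant on atoms, and integrals are compared atom by atom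
    ([le_Rintegral_atoms]). *)

(** * Integrals, limits and filters *)

Lemma cvg_initial (S : choiceType) (U : topologicalType) (g : S -> U)
    (F : set_system S) (s : S) : Filter F ->
  g @ F --> g s -> F --> (s : initial_topology g).
Proof.
move=> FF gF A; rewrite nbhsE => -[_ [[V oV <-] Vs] VA].
by apply: filterS VA _; apply: gF; exact: open_nbhs_nbhs.
Qed.

Lemma finite_set_near (X I : choiceType) (F : set_system X) (A : set I)
    (Q : I -> set X) : Filter F -> finite_set A ->
  (forall i, A i -> F (Q i)) -> F (\bigcap_(i in A) Q i).
Proof.
move=> FF /finite_fsetP[B ->] FQ.
by apply: filter_bigI => i iB; exact: FQ.
Qed.

(** A single index serves as the threshold and as the starting time, so that the
    condition is a countable intersection indexed by [nat]. *)
Lemma limn_esup_pinfty (R : realType) (v : nat -> R) :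
  limn_esup (fun n => (v n)%:E) = +oo%E <->
  forall i, exists2 m, (i <= m)%N & i%:R < v m.
Proof.
split=> [/ereal_inf_pinfty H i|H].
  have [_ [m /= im <-]] : exists2 y, [set (v n)%:E | n in [set m | (i <= m)%N]] y &
      (i%:R%:E < y)%E.
    apply: ereal_sup_gt.
    rewrite (H (ereal_sup [set (v n)%:E | n in [set m | (i <= m)%N]])) ?ltry//.
    by exists [set m | (i <= m)%N] => //; exists i.
  by rewrite lte_fin; exists m.
apply/ereal_inf_pinfty => _ [V [N _ NV] <-].
rewrite (_ : [set _ | _ in V] = EFin @` (v @` V)); last by rewrite image_comp.
apply: hasNub_ereal_sup; last by exists (v N), N => //; apply: NV => /=.
move=> [M vM]; have [m] := H (maxn N (Num.bound `|M|)).
rewrite geq_max => /andP[Nm Mm].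
have : v m <= M by apply: vM; exists m => //; apply: NV.
have := archi_boundP (normr_ge0 M); have := ler_norm M.
have : (Num.bound `|M|)%:R <= (maxn N (Num.bound `|M|))%:R :> R.
  by rewrite ler_nat leq_maxr.
by move=> *; lra.
Qed.

Section probability_integrals.
Context {d : measure_display} {T : measurableType d} {R : realType}.
Variable P : probability T R.

Lemma fine_prob_le (A B : set T) : measurable A -> measurable B -> A `<=` B ->
  fine (P A) <= fine (P B).
Proof.
by move=> mA mB AB; rewrite fine_le ?fin_num_measure// le_measure ?inE.
Qed.

Lemma Rintegral_indic (A E : set T) : measurable A -> measurable E ->
  \int[P]_(x in E) \1_A x = fine (P (A `&` E)).
Proof. by move=> mA mE; rewrite /Rintegral integral_indic. Qed.

Lemma Rintegral_cstT (c : R) : \int[P]_x c = c.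
Proof.
have PT : fine (P setT) = 1 by rewrite probability_setT.
by rewrite Rintegral_cst// PT mulr1.
Qed.

Lemma Lnorm1_EFin (f : T -> R) : P.-integrable setT (EFin \o f) ->
  'N[P]_1[EFin \o f]%E = (\int[P]_x `|f x|)%:E.
Proof.
move=> intf; rewrite Lnorm1 /Rintegral fineK//.
exact: integrable_fin_num (integrable_norm intf).
Qed.

Lemma integral_EFin_Rintegral (f : T -> R) E : measurable E ->
  P.-integrable setT (EFin \o f) ->
  (\int[P]_(x in E) (f x)%:E = (\int[P]_(x in E) f x)%:E)%E.
Proof.
move=> mE intf; rewrite /Rintegral fineK//.
by apply: integrable_fin_num => //; exact: integrableS intf.
Qed.

Lemma ge0_Rintegral_subset (f : T -> R) A B : measurable A -> measurable B ->
  A `<=` B -> P.-integrable setT (EFin \o f) -> (forall x, 0 <= f x) ->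
  \int[P]_(x in A) f x <= \int[P]_(x in B) f x.
Proof.
move=> mA mB AB intf f0; rewrite -lee_fin -!integral_EFin_Rintegral//.
apply: ge0_subset_integral => //; last by move=> x _; rewrite lee_fin.
have intB : P.-integrable B (EFin \o f) by exact: integrableS intf.
exact: measurable_int intB.
Qed.

End probability_integrals.

(** For [w] in [B] and [D n] a partition with [B] among its blocks, this is [B];
    defining it as an intersection avoids choosing a block. *)
Definition atom {T : Type} (D : nat -> set (set T)) n w : set T :=
  [set w' | forall B, D n B -> B w -> B w'].

(** The concrete form of membership in the sigma-algebra generated by [D n]. *)
Definition saturated {T : Type} (D : nat -> set (set T)) n (E : set T) :=
  forall w w', atom D n w w' -> E w -> E w'.

(** The concrete form of measurability for the sigma-algebra generated by
    [D n]. *)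
Definition atom_fun {T U : Type} (D : nat -> set (set T)) n (f : T -> U) :=
  forall w w', atom D n w w' -> f w' = f w.

(** * Finite sigma-algebras and their atoms *)

Section filtration.
Context {d : measure_display} {T : measurableType d} {R : realType}.
Variables (P : probability T R) (Sigma D : nat -> set (set T)).
Hypothesis (hSigma : finite_filtration Sigma).
Hypothesis (hD : generating_partitions Sigma D).

Lemma atomE n B w : D n B -> B w -> atom D n w = B.
Proof.
have [_ [_ tI _] _] := hD n.
move=> DB Bw; apply/seteqP; split=> [w' /(_ _ DB Bw)//|w' Bw' C DC Cw].
by rewrite (tI C B DC DB) //; exists w.
Qed.

Lemma atom_in n w : D n (atom D n w).
Proof.
have [_ [cv _ _] _] := hD n.
have [B DB Bw] : cover (D n) id w by rewrite cv.
by rewrite (atomE DB Bw).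
Qed.

Lemma atom_refl n w : atom D n w w. Proof. by []. Qed.
Arguments atom_refl : clear implicits.

Lemma atom_eq n w w' : atom D n w w' -> atom D n w' = atom D n w.
Proof. exact: atomE (atom_in n w). Qed.

Lemma saturated_atom n w : saturated D n (atom D n w).
Proof. by move=> u v uv wu; rewrite -(atom_eq wu). Qed.

Lemma saturatedC n E : saturated D n E -> saturated D n (~` E).
Proof.
by move=> sE u v uv nEu Ev; apply: nEu; apply: sE Ev; rewrite (atom_eq uv).
Qed.

Lemma saturatedI n E F :
  saturated D n E -> saturated D n F -> saturated D n (E `&` F).
Proof. by move=> sE sF u v uv [/(sE _ _ uv) ? /(sF _ _ uv)]. Qed.

Lemma saturatedT n : saturated D n setT. Proof. by []. Qed.

Lemma saturated_bigcup n (I : Type) (Q : set I) (E : I -> set T) :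
  (forall i, Q i -> saturated D n (E i)) -> saturated D n (\bigcup_(i in Q) E i).
Proof. by move=> sE u v uv [i Qi Eu]; exists i => //; exact: sE uv Eu. Qed.

Lemma saturated_preimage n (U : Type) (f : T -> U) Y :
  atom_fun D n f -> saturated D n (f @^-1` Y).
Proof. by move=> cf u v /cf uv; rewrite /preimage /= uv. Qed.

(** The saturated sets form a sigma-algebra containing the blocks; conversely a
    saturated set is the union of the finitely many blocks that it contains. *)
Lemma SigmaE n E : Sigma n E <-> saturated D n E.
Proof.
have [finD [cvr _ _] ->] := hD n; split.
  apply: smallest_sub E; first split => //.
  - by move=> A sA; rewrite setTD; exact: saturatedC.
  - by move=> A sA; exact: saturated_bigcup.
  by move=> B DB u v uv Bu; rewrite -(atomE DB Bu).
move=> sE.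
rewrite (_ : E = \bigcup_(B in D n `&` [set B | B `<=` E]) B); last first.
  apply/seteqP; split => [w Ew|w [B [_]] /[apply]//].
  exists (atom D n w) => //; split; first exact: atom_in.
  by move=> w' /sE; exact.
apply: (@fin_bigcup_measurable _ (g_sigma_algebraType (D n))).
  exact: finite_setIl.
by move=> B [DB _]; exact: sub_sigma_algebra.
Qed.

Lemma saturated_measurable n E : saturated D n E -> measurable E.
Proof. by have [_ _ sub _] := hSigma; move=> /SigmaE; exact: sub. Qed.

Lemma saturatedW n m E : (n <= m)%N -> saturated D n E -> saturated D m E.
Proof.
by have [_ _ _ mono] := hSigma; move=> nm /SigmaE /(mono _ _ nm) /SigmaE.
Qed.

Lemma atom_mono n m w : (n <= m)%N -> atom D m w `<=` atom D n w.
Proof.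
move=> nm w' mw; have := saturatedW nm (@saturated_atom n w).
by move=> /(_ _ _ mw (atom_refl n w)).
Qed.

Lemma measurable_atom n w : measurable (atom D n w).
Proof. exact: (@saturated_measurable n) (@saturated_atom _ _). Qed.

(** The level set through [u] is measurable, hence saturated, so it contains the
    whole block of [u]. *)
Lemma L1_sub_atom_fun n (f : L1 P) : L1_sub P (Sigma n) f -> atom_fun D n f.
Proof.
move=> mf u v uv.
have /SigmaE : Sigma n (f @^-1` [set f u]).
  have [sS _ _ _] := hSigma.
  rewrite -(sigma_algebra_id (sS n)) -[_ @^-1` _]setTI.
  exact: (mf measurableT).
by move=> /(_ _ _ uv erefl).
Qed.

Lemma atom_fun_measurable_Sigma n (f : T -> R) : atom_fun D n f ->
  measurable_fun [set: g_sigma_algebraType (Sigma n)] f.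
Proof.
move=> cf _ Y _; apply: sub_sigma_algebra; apply/SigmaE.
by rewrite setTI; exact: saturated_preimage.
Qed.

Lemma atom_fun_measurable n (f : T -> R) : atom_fun D n f ->
  measurable_fun setT f.
Proof.
move=> cf _ Y _; apply: (@saturated_measurable n).
by rewrite setTI; exact: saturated_preimage.
Qed.

(** Such a function takes finitely many values, one per block. *)
Lemma atom_fun_integrable n (f : T -> R) : atom_fun D n f ->
  P.-integrable setT (EFin \o f).
Proof.
move=> cf; apply: measurable_bounded_integrable => //.
- by rewrite (le_lt_trans (probability_le1 P measurableT)) ?ltry.
- exact: (atom_fun_measurable cf).
- suff /compact_bounded[M [Mr fM]] : compact (range f).
    by exists M; split => // x Mx w _; apply: (fM x Mx); exists w.
  apply: finite_compact.
  have [finD _ _] := hD n.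
  apply: (@sub_finite_set _ _ ((fun B => f (get B)) @` D n)); last exact: finite_image.
  move=> _ [w _ <-]; exists (atom D n w); first exact: atom_in.
  apply: cf; exact: (getI (x := w)).
Qed.

(** Conditioning on a finite partition: a saturated set is a finite disjoint
    union of blocks, so an inequality between integrals may be checked block by
    block. *)
Lemma Rintegral_atoms_ge0 n (f : T -> R) E : saturated D n E ->
  P.-integrable setT (EFin \o f) ->
  (forall w, E w -> 0 <= \int[P]_(x in atom D n w) f x) ->
  0 <= \int[P]_(x in E) f x.
Proof.
move=> sE intf f0.
have [/finite_seqP[s Ds] [cvr _ _] _] := hD n.
suff H (t : seq (set T)) : {subset t <= s} ->
    0 <= \int[P]_(x in E `&` [set x | exists2 B, B \in t & B x]) f x.
  have := H s (fun _ => id); congr (0 <= Rintegral _ _ _).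
  apply/seteqP; split=> [w []//|w Ew]; split => //.
  by exists (atom D n w) => //; have := atom_in n w; rewrite Ds.
(* A block adds something to the list only if it meets [E] outside the earlier
   blocks; it is then contained in [E] and disjoint from them. *)
elim: t => [_|B t ih ts].
  rewrite (_ : _ `&` _ = set0) ?Rintegral_set0//.
  by apply/seteqP; split=> [w [_ [B]]|//]; rewrite in_nil.
have {ih} /ih ih : {subset t <= s} by move=> C Ct; apply: ts; rewrite inE Ct orbT.
set F := [set x | _] in ih.
have DB : D n B by rewrite Ds; apply: ts; rewrite inE eqxx.
have [[w [Ew nFw Bw]]|nw] := pselect (exists w, [/\ E w, ~ F w & B w]); last first.
  rewrite (_ : _ `&` _ = E `&` F)//; apply/seteqP; split=> w [Ew].
    case=> C; rewrite inE => /orP[/eqP-> Bw|Ct Cw].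
      split => //; apply: contrapT => nFw; by apply: nw; exists w.
    by split => //; exists C.
  by case=> C Ct Cw; split => //; exists C => //; rewrite inE Ct orbT.
have aB := atomE DB Bw.
have sF : saturated D n F.
  move=> u v uv [C Ct Cu]; exists C => //.
  have DC : D n C by rewrite Ds; apply: ts; rewrite inE Ct orbT.
  by rewrite -(atomE DC Cu).
have dis x : B x -> ~ F x.
  move=> Bx Fx; apply: nFw; apply: sF Fx.
  by rewrite (atomE DB Bx).
rewrite (_ : _ `&` _ = atom D n w `|` (E `&` F)); last first.
  apply/seteqP; split=> x.
    move=> [Ex [C]]; rewrite inE => /orP[/eqP-> Cx|Ct Cx].
      by left; rewrite aB.
    by right; split => //; exists C.
  case=> [wx|[Ex [C Ct Cx]]]; last by split => //; exists C => //; rewrite inE Ct orbT.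
  split; first exact: sE wx Ew.
  by exists B; rewrite ?inE ?eqxx// -aB.
rewrite Rintegral_setU//.
- by rewrite addr_ge0// f0.
- exact: measurable_atom.
- by apply: (@saturated_measurable n); exact: saturatedI.
- apply: integrableS intf => //; apply: measurableU; first exact: measurable_atom.
  by apply: (@saturated_measurable n); exact: saturatedI.
- by apply/disj_setPS => x [] /=; rewrite aB => Bx [_ /(dis _ Bx)].
Qed.

Lemma le_Rintegral_atoms n (f g : T -> R) E : saturated D n E ->
  P.-integrable setT (EFin \o f) -> P.-integrable setT (EFin \o g) ->
  (forall w, E w ->
     \int[P]_(x in atom D n w) f x <= \int[P]_(x in atom D n w) g x) ->
  \int[P]_(x in E) f x <= \int[P]_(x in E) g x.
Proof.
move=> sE intf intg fg.
have sub F : measurable F -> \int[P]_(x in F) (g x - f x) =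
    \int[P]_(x in F) g x - \int[P]_(x in F) f x.
  by move=> mF; rewrite RintegralB//; [exact: integrableS intg|exact: integrableS intf].
rewrite -subr_ge0 -sub; last exact: saturated_measurable sE.
apply: Rintegral_atoms_ge0 sE _ _.
  rewrite (_ : EFin \o _ = (EFin \o g) \- (EFin \o f))%E; last exact/funext.
  exact: integrableB.
by move=> w Ew; rewrite sub ?subr_ge0 ?fg//; exact: measurable_atom.
Qed.

Lemma eq_Rintegral_atoms n (f g : T -> R) E : saturated D n E ->
  P.-integrable setT (EFin \o f) -> P.-integrable setT (EFin \o g) ->
  (forall w, E w ->
     \int[P]_(x in atom D n w) f x = \int[P]_(x in atom D n w) g x) ->
  \int[P]_(x in E) f x = \int[P]_(x in E) g x.
Proof.
move=> sE intf intg fg; apply/eqP; rewrite eq_le.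
by apply/andP; split; apply: (le_Rintegral_atoms sE) => // w Ew; rewrite fg.
Qed.

Hypothesis (hpos : forall n B, D n B -> (0 < P B)%E).
Hypothesis (hsplit : forall n B, D n B -> exists2 m, (n < m)%N & ~ D m B).

Local Notation pr n w := (fine (P (atom D n w))).

Lemma atom_pr_gt0 n w : 0 < pr n w.
Proof.
apply: fine_gt0; rewrite (hpos (@atom_in n w)) /=.
by rewrite (le_lt_trans (probability_le1 P _)) ?ltry//; exact: measurable_atom.
Qed.

Lemma Rintegral_atom_fun n (f : T -> R) w : atom_fun D n f ->
  \int[P]_(x in atom D n w) f x = f w * pr n w.
Proof.
move=> cf; rewrite (@eq_Rintegral _ _ _ _ _ (cst (f w))).
  by rewrite Rintegral_cst//; exact: measurable_atom.
by move=> x /set_mem wx; rewrite (cf _ _ wx).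
Qed.

(** * Conditional expectations *)

(** The conditional expectation of [h] given the finite sigma-algebra generated
    by [D n]; as every block has positive probability, it is defined
    everywhere. *)
Definition condexp n (h : T -> R) w : R :=
  (\int[P]_(x in atom D n w) h x) / fine (P (atom D n w)).

Lemma atom_fun_condexp n h : atom_fun D n (condexp n h).
Proof. by move=> u v uv; rewrite /condexp (atom_eq uv). Qed.

Lemma condexp_id n h w : atom_fun D n h -> condexp n h w = h w.
Proof.
move=> ch; rewrite /condexp Rintegral_atom_fun//.
by rewrite mulfK// gt_eqF// atom_pr_gt0.
Qed.

Lemma Rintegral_condexp n h E : saturated D n E ->
  P.-integrable setT (EFin \o h) ->
  \int[P]_(x in E) condexp n h x = \int[P]_(x in E) h x.
Proof.
move=> sE inth; apply: (eq_Rintegral_atoms sE) => // [|w Ew].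
  exact: atom_fun_integrable (@atom_fun_condexp n h).
rewrite Rintegral_atom_fun; last exact: atom_fun_condexp.
by rewrite divfK// gt_eqF// atom_pr_gt0.
Qed.

Lemma atom_fun_comp n (U V : Type) (g : U -> V) (f : T -> U) :
  atom_fun D n f -> atom_fun D n (g \o f).
Proof. by move=> cf u v /cf /= ->. Qed.

Lemma Rintegral_norm_condexp n h : P.-integrable setT (EFin \o h) ->
  \int[P]_x `|condexp n h x| <= \int[P]_x `|h x|.
Proof.
move=> inth.
have sT := saturatedT (n := n).
apply: (le_Rintegral_atoms sT) => [||w _].
- apply: (@integrable_norm _ _ _ P _ (condexp n h)).
  exact: atom_fun_integrable (@atom_fun_condexp n h).
- exact: integrable_norm.
- rewrite Rintegral_atom_fun; last exact: (atom_fun_comp _ (@atom_fun_condexp n h)).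
  rewrite normrM normfV (gtr0_norm (atom_pr_gt0 _ _)) divfK ?gt_eqF ?atom_pr_gt0//.
  apply: le_normr_Rintegral; first exact: measurable_atom.
  by apply: integrableS inth => //; exact: measurable_atom.
Qed.

(** * Small atoms *)

(** As some later partition does not contain the block of [w], it cuts it into
    pieces, and a piece other than that of [w] is available. *)
Lemma atom_split n w :
  exists m v, [/\ (n < m)%N, atom D n w v & ~ atom D m w v].
Proof.
have [m nm nD] := hsplit (@atom_in n w).
exists m; apply: contrapT => H; apply: nD.
rewrite (_ : atom D n w = atom D m w); first exact: atom_in.
apply/seteqP; split=> [v nv|]; last exact: (atom_mono (ltnW nm)).
by apply: contrapT => mv; apply: H; exists v.
Qed.

Lemma atom_disj m u v : ~ atom D m u v -> atom D m u `&` atom D m v = set0.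
Proof.
move=> uv; apply/seteqP; split=> // x [ux vx]; apply: uv.
by rewrite -(atom_eq ux) (atom_eq vx).
Qed.

Lemma atom_sub n m w v : (n <= m)%N -> atom D n w v -> atom D m v `<=` atom D n w.
Proof. by move=> nm /atom_eq <-; exact: atom_mono. Qed.

Lemma atom_pr_mono n m w v : (n <= m)%N -> atom D n w v -> pr m v <= pr n w.
Proof.
move=> nm wv; apply: fine_prob_le; [exact: measurable_atom..|exact: atom_sub].
Qed.

(** A block that is cut has two disjoint pieces, so one of them has at most half
    of its probability. *)
Lemma atom_half n w : exists m w',
  [/\ (n <= m)%N, atom D n w w' & pr m w' <= 2^-1 * pr n w].
Proof.
have [m [v [/ltnW nm nv mv]]] := atom_split n w.
have : pr m w + pr m v <= pr n w.
  have mA k u : measurable (atom D k u) by exact: measurable_atom.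
  rewrite -fineD ?fin_num_measure// -measureU//; last exact: atom_disj.
  apply: fine_prob_le => //; first exact: measurableU.
  by rewrite subUset; split; apply: atom_sub.
have [? _|? ?] := leP (pr m w) (2^-1 * pr n w); first by exists m, w; split.
by exists m, v; split => //; lra.
Qed.

Lemma atom_small n w (e : R) : 0 < e -> exists m w',
  [/\ (n <= m)%N, atom D n w w' & pr m w' <= e * pr n w].
Proof.
move=> e0; suff H k : exists m w',
    [/\ (n <= m)%N, atom D n w w' & pr m w' <= 2^-1 ^+ k * pr n w].
  have [k ke] : exists k, 2^-1 ^+ k < e :> R.
    have : (2^-1 : R) ^+ k @[k --> \oo] --> (0 : R).
      by apply: cvg_expr; rewrite ger0_norm ?invr_ge0//; lra.
    move=> /cvgrPdist_lt/(_ _ e0)[k _ /(_ k (leqnn k))].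
    rewrite sub0r normrN ger0_norm; first by exists k.
    by rewrite exprn_ge0 ?invr_ge0.
  have [m [w' [nm ww' le]]] := H k; exists m, w'; split => //.
  by rewrite (le_trans le)// ler_wpM2r ?ltW ?atom_pr_gt0.
elim: k => [|k [m [w' [nm ww' le]]]].
  by exists n, w; split; rewrite ?expr0 ?mul1r.
have [m' [v [mm' wv le']]] := atom_half m w'.
exists m', v; split; first exact: leq_trans mm'.
  exact: (atom_sub nm ww').
by rewrite (le_trans le')// exprS -mulrA ler_wpM2l ?invr_ge0.
Qed.

(** Cutting a small block once more gives two disjoint small blocks at the same
    level. *)
Lemma atom_two_small n w (e : R) : 0 < e -> exists m u v,
  [/\ (n <= m)%N, atom D n w u, atom D n w v, ~ atom D m u v &
      pr m u <= e * pr n w /\ pr m v <= e * pr n w].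
Proof.
move=> e0; have [m [u [nm wu le]]] := atom_small n w e0.
have [m' [v [/ltnW mm' uv nuv]]] := atom_split m u.
exists m', u, v; split => //; first exact: leq_trans mm'.
  exact: (atom_sub nm wu).
by split; apply: le_trans le; apply: atom_pr_mono.
Qed.

(** Only finitely many blocks are involved, so one level [m] serves them all:
    passing to a later level only shrinks the selected blocks. *)
Lemma atoms_two_small n (e : R) : 0 < e ->
  exists m (a b : set T -> T), (n <= m)%N /\ forall w, let B := atom D n w in
    [/\ B (a B), B (b B), ~ atom D m (a B) (b B),
        pr m (a B) <= e * pr n w & pr m (b B) <= e * pr n w].
Proof.
move=> e0.
have /choice[q qP] B : exists q : nat * (T * T), D n B ->
    [/\ (n <= q.1)%N, B q.2.1, B q.2.2, ~ atom D q.1 q.2.1 q.2.2 &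
      pr q.1 q.2.1 <= e * fine (P B) /\ pr q.1 q.2.2 <= e * fine (P B)].
  have [[w Bw]|nB] := pselect (B !=set0); last first.
    have [_ [_ _ ne] _] := hD n.
    by exists (0%N, (point, point)) => /ne.
  have [DB|nDB] := pselect (D n B); last by exists (0%N, (point, point)).
  have [m [u [v H]]] := atom_two_small n w e0.
  by exists (m, (u, v)) => _ /=; move: H; rewrite (atomE DB Bw).
have [/finite_seqP[s Ds] _ _] := hD n.
exists (maxn n (\max_(B <- s) (q B).1)).
exists (fun B => (q B).2.1), (fun B => (q B).2.2).
split => [|w B]; first exact: leq_maxl.
have Bs : B \in s by have := atom_in n w; rewrite Ds.
have [nq Ba Bb nab [pa pb]] := qP B (atom_in n w).
have qm : ((q B).1 <= maxn n (\max_(B <- s) (q B).1))%N.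
  have := @leq_bigmax_seq _ s predT (fun C => (q C).1) B Bs isT.
  by rewrite leq_max => ->; rewrite orbT.
split => //.
- by move=> /(atom_mono qm).
- by apply: le_trans pa; apply: atom_pr_mono.
- by apply: le_trans pb; apply: atom_pr_mono.
Qed.

(** * Densities concentrated on small atoms *)

Lemma atom_fun_indic n E : saturated D n E -> atom_fun D n (\1_E : T -> R).
Proof.
move=> sE u v uv; rewrite !indicE; congr (_%:R); congr nat_of_bool.
apply/idP/idP => /set_mem H; apply/mem_set; last exact: sE uv H.
by apply: sE H; rewrite (atom_eq uv).
Qed.

(** On each block [B] of level [n], all the mass of the integral of [psi] over
    [B] is moved to the block of level [m] around the chosen point [a B]. *)
Definition spike n m (a : set T -> T) (psi : T -> R) w : R :=
  let u := a (atom D n w) in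
  psi w * fine (P (atom D n w)) / fine (P (atom D m u)) * \1_(atom D m u) w.

Lemma atom_fun_spike n m a psi : (n <= m)%N -> atom_fun D n psi ->
  atom_fun D m (spike n m a psi).
Proof.
move=> nm cpsi u v uv; have uvn := atom_mono nm uv.
rewrite /spike (cpsi _ _ uvn) (atom_eq uvn); congr (_ * _).
exact: (atom_fun_indic (@saturated_atom _ _)).
Qed.

Lemma Rintegral_spike n m a psi w : (n <= m)%N -> atom_fun D n psi ->
  atom D n w (a (atom D n w)) ->
  \int[P]_(x in atom D n w) spike n m a psi x = psi w * pr n w.
Proof.
move=> nm cpsi; set u := a _ => wu.
have um : atom D m u `<=` atom D n w by exact: atom_sub.
rewrite (@eq_Rintegral _ _ _ _ _
    (fun x => psi w * pr n w / pr m u * \1_(atom D m u) x)); last first.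
  by move=> x /set_mem wx; rewrite /spike (cpsi _ _ wx) (atom_eq wx).
have mA k v : measurable (atom D k v) by exact: measurable_atom.
rewrite RintegralZl//; last first.
  by apply: (@integrableS _ _ _ _ setT) => //; exact: integrable_indic.
rewrite Rintegral_indic// (setIidl um) divfK// gt_eqF//; exact: atom_pr_gt0.
Qed.

Lemma spike_ge0 n m a psi w : (forall x, 0 <= psi x) -> 0 <= spike n m a psi w.
Proof.
by move=> psi0; rewrite /spike !mulr_ge0 ?invr_ge0 ?fine_ge0//.
Qed.

Lemma spike_val n m a psi w : atom_fun D n psi -> let u := a (atom D n w) in
  atom D n w u -> spike n m a psi u = psi w * pr n w / pr m u.
Proof.
move=> cpsi u wu; rewrite /spike (cpsi _ _ wu) (atom_eq wu) indicE mem_set ?mulr1//.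
Qed.

(** Within each block of level [n], the positive part of [phi] and the amount
    [s / 2] are sent to one tiny block, the negative part and [- s / 2] to a
    disjoint one. The added masses cancel, so the integrals over sets of level
    [n] do not change, while the L^1-norm grows by exactly [s]; and since
    [s / 2 > 0] is present in both pieces, the density takes huge positive and
    huge negative values in every block. *)
Lemma concentrated_density n (phi : T -> R) (s e : R) :
  atom_fun D n phi -> 0 < s -> 0 < e ->
  exists m h C, [/\ (n <= m)%N, atom_fun D m h, saturated D m C,
    fine (P C) <= e + e & [/\
    (forall E, saturated D n E -> \int[P]_(x in E) h x = \int[P]_(x in E) phi x),
    \int[P]_x `|h x| = \int[P]_x `|phi x| + s,
    \int[P]_(x in C) `|h x| = \int[P]_x `|h x|,
    (forall w, exists2 u, atom D n w u & s / 2 / e <= h u) &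
    (forall w, exists2 u, atom D n w u & h u <= - (s / 2 / e))]].
Proof.
move=> cphi s0 e0; have [m [a [b [nm abP]]]] := atoms_two_small n e0.
pose supp (c : set T -> T) := [set w | atom D m (c (atom D n w)) w].
have ssupp c : saturated D m (supp c).
  move=> u v uv; rewrite /supp /= (atom_eq (atom_mono nm uv)) => /atom_eq cu.
  by rewrite -cu.
pose psi1 w := Num.max (phi w) 0 + s / 2.
pose psi2 w := Num.max (- phi w) 0 + s / 2.
have psi12 w : psi1 w - psi2 w = phi w /\ psi1 w + psi2 w = `|phi w| + s.
  rewrite /psi1 /psi2; case/orP: (le_total 0 (phi w)) => p.
    by rewrite ger0_norm// max_l// max_r ?oppr_le0//; split; lra.
  by rewrite ler0_norm// max_r// max_l ?oppr_ge0//; split; lra.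
have c1 : atom_fun D n psi1 by move=> u v /cphi; rewrite /psi1 => ->.
have c2 : atom_fun D n psi2 by move=> u v /cphi; rewrite /psi2 => ->.
have s2 : 0 < s / 2 by rewrite divr_gt0.
have p1 w : s / 2 <= psi1 w by rewrite lerDr le_max lexx orbT.
have p2 w : s / 2 <= psi2 w by rewrite lerDr le_max lexx orbT.
pose h1 := spike n m a psi1; pose h2 := spike n m b psi2.
have h10 w : 0 <= h1 w by apply: spike_ge0 => x; rewrite (le_trans _ (p1 x))// ltW.
have h20 w : 0 <= h2 w by apply: spike_ge0 => x; rewrite (le_trans _ (p2 x))// ltW.
have ch1 : atom_fun D m h1 by exact: atom_fun_spike.
have ch2 : atom_fun D m h2 by exact: atom_fun_spike.
have I1 := atom_fun_integrable ch1; have I2 := atom_fun_integrable ch2.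
have mA k v : measurable (atom D k v) by exact: measurable_atom.
have IS (f : T -> R) E : measurable E -> P.-integrable setT (EFin \o f) ->
    P.-integrable E (EFin \o f) by move=> mE; apply: integrableS.
have h1E w : ~ supp a w -> h1 w = 0.
  by move=> nw; rewrite /h1 /spike indicE memNset ?mulr0.
have h2E w : ~ supp b w -> h2 w = 0.
  by move=> nw; rewrite /h2 /spike indicE memNset ?mulr0.
have ab w : supp a w -> supp b w -> False.
  rewrite /supp /= => aw bw; have [_ _ + _ _] := abP w; apply.
  by rewrite -(atom_eq aw) (atom_eq bw).
pose h w := h1 w - h2 w.
have ch : atom_fun D m h by move=> u v uv; rewrite /h (ch1 _ _ uv) (ch2 _ _ uv).
have Ih := atom_fun_integrable ch.
have normh w : `|h w| = h1 w + h2 w.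
  rewrite /h; have [/ab nb|/h1E->] := pselect (supp a w).
    by rewrite (h2E w) ?subr0 ?addr0 ?ger0_norm.
  by rewrite sub0r normrN add0r ger0_norm.
have small c : (forall w, atom D n w (c (atom D n w))) ->
    (forall w, pr m (c (atom D n w)) <= e * pr n w) -> fine (P (supp c)) <= e.
  move=> cw ce; have msc : measurable (supp c) by exact: saturated_measurable (ssupp c).
  have <- : \int[P]_x \1_(supp c) x = fine (P (supp c)).
    by rewrite Rintegral_indic// setIT.
  have -> : e = \int[P]_x (cst e x).
    by rewrite Rintegral_cstT.
  apply: (le_Rintegral_atoms (saturatedT (n := n))) => [||w _].
  - exact: integrable_indic.
  - exact: finite_measure_integrable_cst.
  rewrite Rintegral_cst// Rintegral_indic//.
  rewrite (_ : supp c `&` _ = atom D m (c (atom D n w))) ?ce//.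
  apply/seteqP; split=> [x []|x cx].
    by rewrite /supp /= => + /atom_eq wx; rewrite wx.
  have wx : atom D n w x by apply: (atom_sub nm (cw w)) cx.
  by split => //; rewrite /supp /= (atom_eq wx).
have aP w : atom D n w (a (atom D n w)) by have [] := abP w.
have bP w : atom D n w (b (atom D n w)) by have [] := abP w.
have mC := saturated_measurable (ssupp _).
exists m, h, (supp a `|` supp b); split => //.
- move=> u v uv [/(ssupp _ _ _ uv)|/(ssupp _ _ _ uv)]; by [left|right].
- have := @measureU2 _ _ _ P (supp a) (supp b) (mC a) (mC b).
  rewrite -(fineK (fin_num_measure P _ (measurableU _ _ (mC a) (mC b)))).
  rewrite -(fineK (fin_num_measure P _ (mC a))) -(fineK (fin_num_measure P _ (mC b))).
  rewrite -EFinD lee_fin => /le_trans; apply; rewrite lerD// small// => w.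
    by have [] := abP w.
  by have [] := abP w.
split.
- move=> E sE; apply: (eq_Rintegral_atoms sE) => // [|w _].
    exact: (atom_fun_integrable cphi).
  rewrite RintegralB//; [|exact: IS|exact: IS].
  by rewrite !Rintegral_spike// -mulrBl (psi12 w).1 Rintegral_atom_fun.
- transitivity (\int[P]_x (`|phi x| + s)); last first.
    rewrite RintegralD//; first by rewrite Rintegral_cstT.
      apply: (@integrable_norm _ _ _ P _ phi); exact: (atom_fun_integrable cphi).
    exact: finite_measure_integrable_cst.
  under eq_Rintegral do rewrite normh.
  apply: (eq_Rintegral_atoms (saturatedT (n := n))) => [||w _].
  + rewrite (_ : _ \o _ = (EFin \o h1) \+ (EFin \o h2))%E; last exact/funext.
    exact: integrableD.
  + by apply: (@atom_fun_integrable n) => u v /cphi ->.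
  rewrite RintegralD//; [|exact: IS|exact: IS].
  rewrite !Rintegral_spike// -mulrDl (psi12 w).2.
  by rewrite (@Rintegral_atom_fun _ (fun x => `|phi x| + s))// => u v /cphi ->.
- rewrite Rintegral_mkcond; apply: eq_Rintegral => x _; rewrite patchE.
  case: ifPn => // /negP xC; rewrite normh h1E ?h2E ?addr0// => xs; apply: xC;
    apply/mem_set.
    by right.
  by left.
- move=> w; exists (a (atom D n w)) => //.
  rewrite /h h2E ?subr0; last first.
    by apply: ab; rewrite /supp /= (atom_eq (aP w)).
  rewrite /h1 (spike_val m c1 (aP w)) -[leRHS]mulrA.
  apply: ler_pM => //; [exact: ltW|by rewrite invr_ge0 ltW|].
  have [_ _ _ + _] := abP w.
  by rewrite ler_pdivlMr ?atom_pr_gt0// ler_pdivrMl.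
- move=> w; exists (b (atom D n w)) => //.
  rewrite /h h1E ?sub0r; last first.
    by move=> /ab; apply; rewrite /supp /= (atom_eq (bP w)).
  rewrite lerN2 /h2 (spike_val m c2 (bP w)) -[leRHS]mulrA.
  apply: ler_pM => //; [exact: ltW|by rewrite invr_ge0 ltW|].
  have [_ _ _ _ +] := abP w.
  by rewrite ler_pdivlMr ?atom_pr_gt0// ler_pdivrMl.
Qed.

(** * The unit ball of martingales and its topology *)

Lemma mfun_atom f n : atom_fun D n (@mfun_at _ _ _ P Sigma f n).
Proof. exact: (L1_sub_atom_fun (set_valP (f n))). Qed.

Lemma mfun_integrable f n :
  P.-integrable setT (EFin \o @mfun_at _ _ _ P Sigma f n).
Proof. exact: atom_fun_integrable (@mfun_atom f n). Qed.

Lemma adapted_ex (g : nat -> T -> R) : (forall n, atom_fun D n (g n)) ->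
  exists f : adapted P Sigma, forall n, mfun_at f n = g n.
Proof.
move=> cg.
have gL n : g n \in Lfun P 1 by apply/Lfun1_integrable/atom_fun_integrable/cg.
have mg n : L1_sub P (Sigma n) (Lfun_Sub (@lexx _ _ 1%E) (gL n) : L1 P).
  exact: (atom_fun_measurable_Sigma (cg n)).
by exists (fun n => SigSub (mem_set (mg n))) => n; rewrite /mfun_at.
Qed.

Lemma M11P (f : adapted P Sigma) : M11 P Sigma f <->
  (forall n m E, (n <= m)%N -> saturated D n E ->
     \int[P]_(x in E) mfun_at f n x = \int[P]_(x in E) mfun_at f m x) /\
  (forall n, \int[P]_x `|mfun_at f n x| <= 1).
Proof.
have Mf : martingale P Sigma f <-> forall n m E, (n <= m)%N -> saturated D n E ->
     \int[P]_(x in E) mfun_at f n x = \int[P]_(x in E) mfun_at f m x.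
  split=> Mf n m E nm.
    move=> sE; have mE := saturated_measurable sE.
    have /SigmaE/(Mf _ _ _ nm) := sE.
    rewrite !integral_EFin_Rintegral//; try exact: mfun_integrable.
    by case.
  move=> /SigmaE sE; have mE := saturated_measurable sE.
  rewrite !integral_EFin_Rintegral//; try exact: mfun_integrable.
  by rewrite (Mf n m).
have Nf : (martingale_norm f <= 1)%E <-> forall n, \int[P]_x `|mfun_at f n x| <= 1.
  split => Nf.
    move=> n; rewrite -lee_fin -Lnorm1_EFin; last exact: mfun_integrable.
    by apply: le_trans Nf; apply: ereal_sup_ubound; exists n.
  apply: ge_ereal_sup => _ [n _ <-].
  by rewrite Lnorm1_EFin ?lee_fin//; exact: mfun_integrable.
split=> [[[/Mf ? _] /Nf ?]//|[/Mf ? /Nf N1]]; split => //; split => //.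
by rewrite (le_lt_trans N1)// ltry.
Qed.

Definition coord n (g : M11 P Sigma) : L1 P := set_val (set_val g n).

Lemma coord_continuous n : continuous (coord n).
Proof.
move=> g; rewrite /coord.
apply: (@continuous_comp _ _ _ (fun g : M11 P Sigma => (set_val g : adapted P Sigma) n)
   set_val); last exact: initial_continuous.
apply: (@continuous_comp _ _ _ (set_val : M11 P Sigma -> adapted P Sigma)
   (@proj _ _ n)); [exact: initial_continuous|exact: proj_continuous].
Qed.

Definition L1dist n (f g : M11 P Sigma) : R :=
  \int[P]_x `|mfun_at (set_val f) n x - mfun_at (set_val g) n x|.

Lemma integrable_mfunB (f g : M11 P Sigma) n : P.-integrable setT
  (EFin \o (fun x => mfun_at (set_val f) n x - mfun_at (set_val g) n x)).
Proof.
apply: (@atom_fun_integrable n) => u v uv.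
by rewrite !(@mfun_atom _ _ _ _ uv).
Qed.

Lemma coord_ball n f g e : ball (coord n f) e (coord n g) <-> L1dist n f g < e.
Proof.
rewrite -[ball _ _ _]/(L1_ball _ _ _) /L1_ball.
by rewrite (Lnorm1_EFin (integrable_mfunB f g n)) lte_fin.
Qed.

Lemma L1dist_nbhs n f e : 0 < e -> nbhs f [set g | L1dist n f g < e].
Proof.
move=> e0; apply: (@filterS _ (nbhs f) _ (coord n @^-1` ball (coord n f) e)).
  by move=> g /coord_ball.
exact: (@coord_continuous n f _ (nbhsx_ballx (coord n f) e e0)).
Qed.

(** Convergence is tested on each coordinate, since all the topologies involved
    are initial. *)
Lemma M11_cvg (u : nat -> M11 P Sigma) f :
  (forall n, L1dist n f (u k) @[k --> \oo] --> (0 : R)) -> u @ \oo --> f.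
Proof.
move=> uf; apply: cvg_initial; apply/cvg_sup => n.
apply: cvg_initial; apply: cvg_initial; apply/cvg_ballP => e e0.
have /cvgrPdist_lt/(_ _ e0) := uf n; apply: filterS => k.
rewrite sub0r normrN ger0_norm; first by move=> ?; apply/coord_ball.
by apply: Rintegral_ge0.
Qed.

(** Evaluation at a point is continuous for the L^1-distance, because the block
    of the point has positive probability. *)
Lemma mfun_at_L1dist m (f g : M11 P Sigma) u :
  `|mfun_at (set_val f) m u - mfun_at (set_val g) m u| * pr m u <= L1dist m f g.
Proof.
have c : atom_fun D m
    (fun x => `|mfun_at (set_val f) m x - mfun_at (set_val g) m x|).
  by move=> v w vw; rewrite !(@mfun_atom _ _ _ _ vw).
rewrite -(Rintegral_atom_fun u c).
apply: ge0_Rintegral_subset => //; first exact: measurable_atom.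
exact: (atom_fun_integrable c).
Qed.

Lemma Rintegral_L1dist m (f g : M11 P Sigma) C : measurable C ->
  \int[P]_(x in C) `|mfun_at (set_val f) m x| -
    \int[P]_(x in C) `|mfun_at (set_val g) m x| <= L1dist m f g.
Proof.
move=> mC.
have c : atom_fun D m
    (fun x => `|mfun_at (set_val f) m x - mfun_at (set_val g) m x|).
  by move=> v w vw; rewrite !(@mfun_atom _ _ _ _ vw).
have IS (h : M11 P Sigma) :
    P.-integrable C (EFin \o (fun x => `|mfun_at (set_val h) m x|)).
  apply: (@integrableS _ _ _ _ setT) => //.
  by apply: (@integrable_norm _ _ _ P _ (mfun_at _ m)); exact: mfun_integrable.
rewrite -RintegralB//.
apply: (@le_trans _ _
  (\int[P]_(x in C) `|mfun_at (set_val f) m x - mfun_at (set_val g) m x|)).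
  apply: le_Rintegral => //.
  - exact: (integrableB mC (IS f) (IS g)).
  - exact: integrableS (atom_fun_integrable c).
  - by move=> x _; exact: lerB_dist.
by apply: ge0_Rintegral_subset => //; exact: (atom_fun_integrable c).
Qed.

(** * Generic martingales *)

(** The large values are those chained along branches. The mass on [C] forces
    the mass outside [C] to stay below [4^-1 ^+ j] at all later times, as the
    L^1-norm cannot exceed [1]. Both conditions concern a single time [m], so
    that they define an open set. *)
Definition oscillating_concentrated j : set (M11 P Sigma) :=
  [set f | exists m, [/\ (j <= m)%N,
    forall B, D j B -> exists2 u, B u & j%:R < mfun_at (set_val f) m u,
    forall B, D j B -> exists2 u, B u & mfun_at (set_val f) m u < - j%:R &
    exists C, [/\ saturated D m C, fine (P C) < (4^-1) ^+ j &
      1 - (4^-1) ^+ j < \int[P]_(x in C) `|mfun_at (set_val f) m x| ]]].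

(** For a fixed time, there are finitely many strict inequalities between
    continuous functions of one coordinate. *)
Lemma oscillating_concentrated_open j : open (oscillating_concentrated j).
Proof.
rewrite openE => f [m [jm up dn [C [sC PC IC]]]]; rewrite /interior.
have mC := saturated_measurable sC.
have [finD [_ _ ne] _] := hD j.
have nup : nbhs f (\bigcap_(B in D j) [set g : M11 P Sigma |
    exists2 u, B u & j%:R < mfun_at (set_val g) m u]).
  apply: finite_set_near => // B DB; have [u Bu fu] := up B DB.
  have e0 : 0 < (mfun_at (set_val f) m u - j%:R) * pr m u.
    by rewrite mulr_gt0 ?atom_pr_gt0// subr_gt0.
  apply: filterS (L1dist_nbhs m f e0) => g /= fg; exists u => //.
  have := le_lt_trans (mfun_at_L1dist m f g u) fg.
  rewrite ltr_pM2r ?atom_pr_gt0//.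
  by move=> /(le_lt_trans (ler_norm _)); lra.
have ndn : nbhs f (\bigcap_(B in D j) [set g : M11 P Sigma |
    exists2 u, B u & mfun_at (set_val g) m u < - j%:R]).
  apply: finite_set_near => // B DB; have [u Bu fu] := dn B DB.
  have e0 : 0 < (- j%:R - mfun_at (set_val f) m u) * pr m u.
    by rewrite mulr_gt0 ?atom_pr_gt0// subr_gt0.
  apply: filterS (L1dist_nbhs m f e0) => g /= fg; exists u => //.
  have := le_lt_trans (mfun_at_L1dist m f g u) fg.
  rewrite ltr_pM2r ?atom_pr_gt0// distrC.
  by move=> /(le_lt_trans (ler_norm _)); lra.
have e0 : 0 < \int[P]_(x in C) `|mfun_at (set_val f) m x| - (1 - (4^-1) ^+ j).
  by rewrite subr_gt0.
move: (L1dist_nbhs m f e0); apply: filterS2 (filterI nup ndn) => g [gu gd] /= fg.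
exists m; split => //.
exists C; split => //.
have := le_lt_trans (@Rintegral_L1dist m f g _ mC) fg.
by lra.
Qed.

(** The martingale is shrunk by a factor slightly below [1], stopped at a time
    [n], and the missing mass [s] is spent on tiny blocks as in
    [concentrated_density]. Shrinking makes [s] positive even when the norm
    is [1]. *)
Lemma oscillating_concentrated_approx j k f :
  exists g : M11 P Sigma, oscillating_concentrated j g /\
    forall i, (i <= k)%N -> L1dist i f g <= k.+2%:R^-1.
Proof.
have [Mf Nf] := (M11P _).1 (set_valP f).
pose n := maxn k j; pose c : R := 1 - k.+2%:R^-1.
have k2 : (0 : R) < k.+2%:R^-1 by rewrite invr_gt0.
have k21 : (k.+2%:R^-1 : R) < 1 by rewrite invf_lt1 ?ltr1n.
have c0 : 0 <= c by rewrite subr_ge0 ltW.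
pose phi x := c * mfun_at (set_val f) n x.
have Iphi : \int[P]_x `|phi x| = c * \int[P]_x `|mfun_at (set_val f) n x|.
  rewrite -RintegralZl//; last first.
    by apply: (@integrable_norm _ _ _ P _ (mfun_at _ n)); exact: mfun_integrable.
  by apply: eq_Rintegral => x _; rewrite normrM ger0_norm.
pose s := 1 - \int[P]_x `|phi x|.
have s0 : 0 < s.
  rewrite subr_gt0 Iphi (@le_lt_trans _ _ (c * 1))//.
    by rewrite ler_wpM2l// Nf.
  by rewrite mulr1 ltrBlDr ltrDl.
have eps0 : 0 < (4^-1 : R) ^+ j by rewrite exprn_gt0// invr_gt0.
(* The first bound makes the support of the added masses small, the second one
   makes the values that they produce exceed [j]. *)
pose e := Num.min ((4^-1 : R) ^+ j / 4) (s / 2 / j.+1%:R).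
have e0 : 0 < e by rewrite lt_min !divr_gt0.
have e1 : e + e < (4^-1 : R) ^+ j.
  have : e <= (4^-1 : R) ^+ j / 4 by rewrite ge_min lexx.
  lra.
have e2 : j%:R < s / 2 / e.
  rewrite ltr_pdivlMr// mulrC (@le_lt_trans _ _ (s / 2 / j.+1%:R * j%:R))//.
    by rewrite ler_wpM2r// ge_min lexx orbT.
  by rewrite -mulrA gtr_pMr ?divr_gt0// mulrC ltr_pdivrMr// mul1r ltr_nat.
have cphi : atom_fun D n phi by move=> u v uv; rewrite /phi (@mfun_atom _ _ _ _ uv).
have [m [h [C [nm ch sC PC [Ih Nh Ch up dn]]]]] := concentrated_density cphi s0 e0.
have inth := atom_fun_integrable ch.
have N1 : \int[P]_x `|h x| = 1 by rewrite Nh; rewrite /s; lra.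
have [g0 g0E] := adapted_ex (fun i => @atom_fun_condexp i h).
have Mg : M11 P Sigma g0.
  apply/M11P; split=> [i l E il sE|i].
    rewrite !g0E !Rintegral_condexp//; exact: saturatedW sE.
  by rewrite g0E -N1; exact: Rintegral_norm_condexp.
pose g : M11 P Sigma := SigSub (mem_set Mg).
have gE i : mfun_at (set_val g) i = condexp i h by rewrite -g0E.
have gm : mfun_at (set_val g) m = h.
  by rewrite gE; apply/funext => x; rewrite condexp_id.
exists g; split.
  have jn : (j <= n)%N by exact: leq_maxr.
  exists m; rewrite gm; split.
  - exact: leq_trans jn nm.
  - move=> B DB; have [_ [_ _ ne] _] := hD j; have [w Bw] := ne B DB.
    have [u wu hu] := up w; exists u; last exact: lt_le_trans hu.
    by rewrite -(atomE DB Bw); exact: atom_mono wu.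
  - move=> B DB; have [_ [_ _ ne] _] := hD j; have [w Bw] := ne B DB.
    have [u wu hu] := dn w; exists u; last by rewrite (le_lt_trans hu)// ltrN2.
    by rewrite -(atomE DB Bw); exact: atom_mono wu.
  - exists C; split => //; first exact: le_lt_trans e1.
    by rewrite Ch N1 ltrBlDr ltrDl.
move=> i ik; have iin : (i <= n)%N by rewrite (leq_trans ik)// leq_maxl.
have gi x : mfun_at (set_val g) i x = c * mfun_at (set_val f) i x.
  rewrite gE /condexp Ih; last exact: saturatedW iin (@saturated_atom _ _).
  have mA : measurable (atom D i x) by exact: measurable_atom.
  rewrite RintegralZl//; last first.
    by apply: (@integrableS _ _ _ _ setT) => //; exact: mfun_integrable.
  rewrite -(Mf i n)//; last exact: saturated_atom.
  rewrite (Rintegral_atom_fun _ (@mfun_atom _ _)) mulrA mulfK// gt_eqF//.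
  exact: atom_pr_gt0.
rewrite /L1dist.
rewrite (@eq_Rintegral _ _ _ _ _ (fun x => k.+2%:R^-1 * `|mfun_at (set_val f) i x|)).
  rewrite RintegralZl//; last first.
    by apply: (@integrable_norm _ _ _ P _ (mfun_at _ i)); exact: mfun_integrable.
  by rewrite ler_piMr// ?Nf// ltW.
move=> x _; rewrite gi /c (_ : _ - _ = k.+2%:R^-1 * mfun_at (set_val f) i x); last ring.
by rewrite normrM ger0_norm// ltW.
Qed.

(** The set is closed, and every martingale is a limit of martingales outside
    it. *)
Lemma oscillating_concentratedC_nowhere_dense j :
  nowhere_dense (~` oscillating_concentrated j).
Proof.
rewrite /nowhere_dense -(closure_id _).1; last first.
  exact/open_closedC/oscillating_concentrated_open.
apply/seteqP; split=> // f fW.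
have /choice[u uP] k := oscillating_concentrated_approx j k f.
have uf : u @ \oo --> f.
  apply: M11_cvg => n; apply/cvgrPdist_le => e e0.
  have /cvgrPdist_le/(_ _ e0) [N _ NP] : (k.+1%:R^-1 : R) @[k --> \oo] --> (0 : R).
    exact: cvg_harmonic.
  exists (maxn n N) => // k /=; rewrite geq_max => /andP[nk Nk].
  have d0 : 0 <= L1dist n f (u k) by apply: Rintegral_ge0.
  rewrite sub0r normrN ger0_norm// (le_trans ((uP k).2 n nk))//.
  have := NP k.+1 (leq_trans Nk (leqnSn _)).
  by rewrite sub0r normrN ger0_norm// invr_ge0.
have [N _ /(_ N (leqnn N))/=] := uf _ fW.
by apply; have [] := uP N.
Qed.

(** * Almost sure convergence *)

(** The maximal inequality of Doob for a nonnegative submartingale, localized to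
    a set [A] that is known at time [m]. On the set [U N] of the points of [A]
    where the level [lambda] has been crossed before time [m + N], the integral
    of [g (m + N)] is at least [lambda] times the probability: the part newly
    crossed contributes by definition, the older part because the integral over
    it can only grow. *)
Lemma maximal_inequality (g : nat -> T -> R) A m (e lambda : R) :
  (forall i, atom_fun D i (g i)) -> (forall i x, 0 <= g i x) ->
  (forall i l E, (i <= l)%N -> saturated D i E ->
     \int[P]_(x in E) g i x <= \int[P]_(x in E) g l x) ->
  saturated D m A -> (forall i, (m <= i)%N -> \int[P]_(x in A) g i x <= e) ->
  0 < lambda ->
  (P (A `&` [set x | exists2 i, (m <= i)%N & (lambda < g i x)%R]) <=
   (e / lambda)%:E)%E.
Proof.
move=> cg g0 subm sA Ae l0.
pose U N := A `&` [set x | exists2 i, (m <= i < m + N)%N & lambda < g i x].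
have Ig i E : measurable E -> P.-integrable E (EFin \o g i).
  by move=> mE; apply: integrableS (atom_fun_integrable (cg i)).
have sU N : saturated D (m + N) (U N).
  apply: saturatedI; first by apply: saturatedW sA; exact: leq_addr.
  move=> u v uv [i /andP[mi iN] gu]; exists i; first by rewrite mi.
  by rewrite (cg i _ _ (atom_mono (ltnW iN) uv)).
have mU N := saturated_measurable (sU N).
have UN N : lambda * fine (P (U N)) <= \int[P]_(x in U N) g (m + N)%N x.
  elim: N => [|N ih].
    rewrite (_ : U _ = set0) ?measure0 ?mulr0 ?Rintegral_set0//.
    apply/seteqP; split=> // x [_ [i]]; rewrite addn0 => /andP[mi].
    by rewrite ltnNge mi.
  pose V := (A `&` g (m + N)%N @^-1` [set y | lambda < y]) `&` ~` U N.
  have sV : saturated D (m + N) V.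
    apply: saturatedI; last exact: saturatedC.
    apply: saturatedI; first by apply: saturatedW sA; exact: leq_addr.
    exact: saturated_preimage.
  have mV := saturated_measurable sV.
  have UV : U N.+1 = U N `|` V.
    apply/seteqP; split=> x.
      move=> [Ax [i /andP[mi]]]; rewrite addnS ltnS leq_eqVlt => /orP[/eqP ->|iN] gx.
        by have [|nU] := pselect (U N x); [left|right].
      by left; split => //; exists i => //; rewrite mi.
    case=> [[Ax [i /andP[mi iN] gx]]|[[Ax gx] _]]; split => //.
      by exists i => //; rewrite mi addnS ltnS ltnW.
    by exists (m + N)%N => //; rewrite leq_addr addnS leqnn.
  have dUV : U N `&` V = set0 by rewrite /V setIC -setIA setICl setI0.
  have : \int[P]_(x in U N.+1) g (m + N)%N x <=
      \int[P]_(x in U N.+1) g (m + N.+1)%N x.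
    apply: subm; first by rewrite leq_add2l.
    by rewrite UV => u v uv [/(sU _ _ _ uv)|/(sV _ _ uv)]; [left|right].
  apply: le_trans; rewrite UV Rintegral_setU//; last 2 first.
  - by apply: Ig; exact: measurableU.
  - by rewrite disj_set2E dUV eqxx.
  rewrite measureU// fineD ?fin_num_measure// mulrDr lerD//.
  rewrite -Rintegral_cst//; apply: le_Rintegral => //.
  - exact: finite_measure_integrable_cst.
  - exact: Ig.
  - by move=> x [[_ /ltW]].
rewrite (_ : A `&` _ = \bigcup_N U N); last first.
  apply/seteqP; split=> x.
    move=> [Ax [i mi gx]]; exists (i.+1 - m)%N => //; split => //; exists i => //.
    by rewrite mi subnKC ?ltnSn// (leq_trans mi).
  by move=> [N _ [Ax [i /andP[mi _] gx]]]; split => //; exists i.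
have ndU : nondecreasing_seq U.
  apply/nondecreasing_seqP => N; apply/subsetPset => x [Ax [i /andP[mi iN] gx]].
  by split => //; exists i => //; rewrite mi addnS ltnS ltnW.
have mUU : measurable (\bigcup_N U N) by exact: bigcupT_measurable.
have cU := nondecreasing_cvg_mu (mu := P) mU mUU ndU.
rewrite -(cvg_lim _ cU)//; apply: lime_le.
  by apply/cvg_ex; eexists; exact: cU.
apply: nearW => N /=; rewrite -(fineK (fin_num_measure P _ (mU N))) lee_fin.
rewrite ler_pdivlMr// mulrC (le_trans (UN N))//.
apply: le_trans (Ae (m + N)%N _); last exact: leq_addr.
have sAN : saturated D (m + N) A by apply: saturatedW sA; exact: leq_addr.
have mA := saturated_measurable sA.
apply: ge0_Rintegral_subset => //; first by move=> x [].
exact: (atom_fun_integrable (cg _)).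
Qed.

(** On a block of level [i], [mfun_at (set_val f) i] is constant, equal to the
    mean of [mfun_at (set_val f) l]. *)
Lemma Rintegral_norm_le (f : M11 P Sigma) i l E :
  (i <= l)%N -> saturated D i E ->
  \int[P]_(x in E) `|mfun_at (set_val f) i x| <=
  \int[P]_(x in E) `|mfun_at (set_val f) l x|.
Proof.
move=> il sE; have [Mf _] := (M11P _).1 (set_valP f).
apply: (le_Rintegral_atoms sE) => [||w _].
- by apply: (@integrable_norm _ _ _ P _ (mfun_at _ i)); exact: mfun_integrable.
- by apply: (@integrable_norm _ _ _ P _ (mfun_at _ l)); exact: mfun_integrable.
have mA : measurable (atom D i w) by exact: measurable_atom.
rewrite (Rintegral_atom_fun _ (atom_fun_comp Num.norm (@mfun_atom (set_val f) i))) /=.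
rewrite -[X in _ * X](gtr0_norm (atom_pr_gt0 i w)) -normrM.
rewrite -Rintegral_atom_fun; last exact: mfun_atom.
rewrite (Mf i l)//; last exact: saturated_atom.
apply: le_normr_Rintegral => //.
by apply: (@integrableS _ _ _ _ setT) => //; exact: mfun_integrable.
Qed.

(** Outside the set [C] given by [oscillating_concentrated j], the integrals of
    the absolute values are below [4^-1 ^+ j] from some time on, so by the maximal
    inequality the values exceed [2^-1 ^+ j] later only on a set of probability
    at most [2^-1 ^+ j]. The exceptional sets have summable probabilities, and
    the Borel-Cantelli lemma concludes. *)
Lemma concentrated_cvg0 (f : M11 P Sigma) :
  (forall j, oscillating_concentrated j f) ->
  {ae P, forall w, mfun_at (set_val f) n w @[n --> \oo] --> (0 : R)}.
Proof.
move=> fW; have [_ Nf] := (M11P _).1 (set_valP f).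
have /choice[mC mCP] j : exists mC : nat * set T, [/\ saturated D mC.1 mC.2,
    fine (P mC.2) < (4^-1) ^+ j &
    1 - (4^-1) ^+ j < \int[P]_(x in mC.2) `|mfun_at (set_val f) mC.1 x|].
  by have [m [_ _ _ [C H]]] := fW j; exists (m, C).
pose V j := ~` (mC j).2 `&` [set x | exists2 i, ((mC j).1 <= i)%N &
  (2^-1) ^+ j < `|mfun_at (set_val f) i x|].
pose B j := (mC j).2 `|` V j.
have mCj j : measurable (mC j).2 by have [/saturated_measurable] := mCP j.
have mf i : measurable_fun setT (fun x => `|mfun_at (set_val f) i x|).
  exact: atom_fun_measurable (atom_fun_comp Num.norm (@mfun_atom (set_val f) i)).
have mV j : measurable (V j).
  apply: measurableI; first exact: measurableC.
  rewrite (_ : [set x | _] = \bigcup_(i in [set i | ((mC j).1 <= i)%N])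
      (setT `&` (fun x => `|mfun_at (set_val f) i x|) @^-1` `](2^-1) ^+ j, +oo[)).
    by apply: bigcup_measurable => i _; exact: mf.
  apply/seteqP; split=> [x [i mi fx]|x [i mi [_]]].
    by exists i => //; split => //=; rewrite in_itv /= andbT.
  by rewrite /= in_itv /= andbT => fx; exists i.
have mB j : measurable (B j) by exact: measurableU.
(* The bound [2 * 2^-1 ^+ j], in the form summed by [epsilon_trick0]. *)
have PB j : (P (B j) <= (4 / (2 ^ j.+1)%:R)%:E)%E.
  have [sC PC IC] := mCP j.
  apply: (le_trans (measureU2 _ (mCj j) (mV j))).
  have p2 : (0 : R) < 2^-1 ^+ j by rewrite exprn_gt0// invr_gt0.
  have E4 : 4^-1 ^+ j = 2^-1 ^+ j * 2^-1 ^+ j :> R.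
    by rewrite -exprMn -invfM -natrM.
  have PV : (P (V j) <= (4^-1 ^+ j / 2^-1 ^+ j)%:E)%E.
    apply: (maximal_inequality (g := fun i x => `|mfun_at (set_val f) i x|)) => //.
    - by move=> i; exact: (atom_fun_comp Num.norm (@mfun_atom (set_val f) i)).
    - by move=> i l E; exact: Rintegral_norm_le.
    - exact: saturatedC.
    - move=> i mi; have := Nf i.
      have := @Rintegral_norm_le f _ _ _ mi sC.
      rewrite -(setUv (mC j).2) Rintegral_setU//; first by lra.
      + exact: measurableC.
      + by rewrite setUv; exact: integrable_norm (@mfun_integrable _ _).
      + by rewrite disj_set2E setICr eqxx.
  have {}PC : (P (mC j).2 <= (4^-1 ^+ j)%:E)%E.
    by rewrite -(fineK (fin_num_measure P _ (mCj j))) lee_fin ltW.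
  apply: (le_trans (leeD PC PV)); rewrite -EFinD lee_fin.
  rewrite E4 mulfK ?gt_eqF//.
  have p1 : 2^-1 ^+ j <= 1 :> R by rewrite exprn_ile1 ?invr_ge0// invf_le1 ?ler1n.
  have -> : 4 / (2 ^ j.+1)%:R = 2 * 2^-1 ^+ j :> R.
    rewrite natrX exprS invfM exprVn mulrA; congr (_ * _).
    by lra.
  nra.
have B0 : P (lim_sup_set B) = 0%E.
  apply: lim_sup_set_cvg0 => //.
  apply: (@le_lt_trans _ _ 4%:E); last exact: ltry.
  have e4 : (0 : R) <= 4 by [].
  apply: le_trans (epsilon_trick0 predT e4).
  by apply: lee_nneseries => // i _; exact: PB.
exists (lim_sup_set B); split => //.
  apply: bigcap_measurable => // k _; exact: bigcup_measurable.
move=> w nw; apply: contrapT => nB; apply: nw.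
have {nB} [n nB] : exists n, forall j, (n <= j)%N -> ~ B j w.
  apply: contrapT => H; apply: nB => n _; apply: contrapT => H'.
  by apply: H; exists n => j nj Bj; apply: H'; exists j.
apply/cvgrPdist_le => e e0.
have : (2^-1 : R) ^+ k @[k --> \oo] --> (0 : R).
  by apply: cvg_expr; rewrite ger0_norm ?invr_ge0//; lra.
move=> /cvgrPdist_lt/(_ _ e0)[k _ /(_ (maxn k n) (leq_maxl _ _))].
rewrite sub0r normrN ger0_norm ?exprn_ge0 ?invr_ge0// => ke.
have nBw := nB _ (leq_maxr k n).
exists (mC (maxn k n)).1 => // i /= mi.
rewrite sub0r normrN (le_trans _ (ltW ke))// leNgt; apply/negP => fi.
apply: nBw; have [Cw|nC] := pselect ((mC (maxn k n)).2 w); first by left.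
by right; split => //; exists i.
Qed.

(** * Oscillation along branches *)

Lemma value_atE (f : adapted P Sigma) (x : branches D) m w :
  branch_at x m w -> value_at_branch f x m = mfun_at f m w.
Proof.
move=> xw; rewrite /value_at_branch /value_on.
have aE : atom D m w = branch_at x m.
  by apply: atomE xw; exact: (set_valP (set_val x m)).
have E : mfun_at f m @` branch_at x m = [set mfun_at f m w].
  rewrite -aE; apply/seteqP; split=> [_ [u wu <-]|_ ->]; last by exists w.
  exact: mfun_atom wu.
rewrite E; set v := mfun_at f m w.
have : [set v] = [set get [set y | [set v] = [set y]]].
  exact: (getI (P := [set y | [set v] = [set y]]) (x := v)).
by move=> /seteqP[/(_ _ erefl)].
Qed.

Definition oscillates_beyond (f : adapted P Sigma) (x : branches D) i :=
  (exists2 m, (i <= m)%N & i%:R < value_at_branch f x m) /\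
  (exists2 m, (i <= m)%N & value_at_branch f x m < - i%:R).

Lemma oscillates_beyondP f (x : branches D) :
  limn_esup (fun n => (value_at_branch f x n)%:E) = +oo%E /\
  limn_einf (fun n => (value_at_branch f x n)%:E) = -oo%E <->
  forall i, oscillates_beyond f x i.
Proof.
have -> : limn_einf (fun n => (value_at_branch f x n)%:E) = -oo%E <->
    limn_esup (fun n => (- value_at_branch f x n)%:E) = +oo%E.
  rewrite /limn_einf -[X in limn_esup X]/(fun n => (- value_at_branch f x n)%:E).
  by split=> [/eqP|->//]; rewrite eqe_oppLR => /eqP.
rewrite !limn_esup_pinfty; split=> [[H1 H2] i|H].
  by split; [exact: H1|have [m im] := H2 i; exists m => //; lra].
by split=> i; have [? [m im ?]] := H i => //; exists m => //; lra.
Qed.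

Lemma open_branch_at m (Q : set (set T)) :
  open [set x : branches D | Q (branch_at x m)].
Proof.
pose c (x : branches D) : discrete_topology (set_type (D m)) := set_val x m.
have cc : continuous c.
  move=> x; apply: (@continuous_comp _ _ _ (set_val : branches D -> _) (@proj _ _ m)).
    exact: initial_continuous.
  exact: proj_continuous.
rewrite (_ : [set x | _] = c @^-1` [set y | Q (set_val y)])//.
by apply: open_comp => [x _|]; [exact: cc|exact: discrete_open].
Qed.

Lemma oscillates_beyond_open f i : open [set x | oscillates_beyond f x i].
Proof.
rewrite (_ : [set x | _] =
  (\bigcup_(m in [set m | (i <= m)%N])
    [set x | [set B | i%:R < value_on (mfun_at f m) B] (branch_at x m)]) `&`
  (\bigcup_(m in [set m | (i <= m)%N])
    [set x | [set B | value_on (mfun_at f m) B < - i%:R] (branch_at x m)]))//.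
  by apply: openI; apply: bigcup_open => m _; exact: open_branch_at.
Qed.

Lemma oscillates_beyond_Gdelta f : Gdelta [set x | forall i, oscillates_beyond f x i].
Proof.
exists (fun i => [set x | oscillates_beyond f x i]).
  by move=> i; exact: oscillates_beyond_open.
by apply/seteqP; split=> [x H i _|x H i]; [exact: H|exact: (H i I)].
Qed.

(** A large positive value is found first, then a large negative value inside the
    block carrying the positive one, which thus persists at the new point. *)
Lemma oscillating_step (f : M11 P Sigma) n w i :
  (forall j, oscillating_concentrated j f) ->
  exists q : nat * T, [/\ (n < q.1)%N, atom D n w q.2,
    exists2 m, (i <= m <= q.1)%N & i%:R < mfun_at (set_val f) m q.2 &
    exists2 m, (i <= m <= q.1)%N & mfun_at (set_val f) m q.2 < - i%:R].
Proof.
move=> fW.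
have [m [nm up _ _]] := fW (maxn n.+1 i).
have [u wu fu] := up _ (@atom_in _ w).
have [m' [mm' _ dn _]] := fW (maxn m i).
have [v uv fv] := dn _ (@atom_in _ u).
move: nm mm'; rewrite !geq_max => /andP[nm im] /andP[mm' im'].
have muv : atom D m u v by apply: atom_mono uv; exact: leq_maxl.
exists (m', v); split => /=.
- exact: leq_trans mm'.
- apply: (atom_sub _ _ muv) => //; first exact: ltnW.
  by apply: atom_mono wu; rewrite leq_max ltnW.
- exists m; first by rewrite im.
  rewrite (@mfun_atom _ _ _ _ muv); apply: le_lt_trans fu.
  by rewrite ler_nat leq_maxr.
- exists m'; first by rewrite im' /=.
  by apply: lt_le_trans fv _; rewrite lerN2 ler_nat leq_maxr.
Qed.

(** Near [x0], a branch with the required oscillation is obtained from a sequence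
    of points [w i] such that [w i.+1] lies in the block of [w i] at level
    [(s i).1]: the branch [Y] follows the blocks that eventually contain all the
    [w i]. *)
Lemma oscillates_beyond_dense (f : M11 P Sigma) :
  (forall j, oscillating_concentrated j f) ->
  dense [set x | forall i, oscillates_beyond (set_val f) x i].
Proof.
move=> fW O [x0 Ox0] oO.
suff /choice[y yP] k : exists y : branches D,
    (forall i, oscillates_beyond (set_val f) y i) /\
    forall n, (n <= k)%N -> branch_at y n = branch_at x0 n.
  have yx : y @ \oo --> x0.
    apply: cvg_initial; apply/cvg_sup => n; apply: cvg_initial.
    apply: cvg_near_cst; exists n => // k nk; apply/val_inj.
    exact: ((yP k).2 n nk).
  have [N _ /(_ N (leqnn N)) ON] := yx _ (open_nbhs_nbhs (conj oO Ox0)).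
  by exists (y N); split => //; exact: (yP N).1.
have Dx0 n : D n (branch_at x0 n) by exact: set_valP.
have [w0 xw0] : branch_at x0 k !=set0.
  by have [_ [_ _ ne] _] := hD k; exact: ne.
have /choice[step stepP] (q : nat * (nat * T)) := oscillating_step q.2.1 q.2.2 q.1 fW.
pose s := fix s i := if i is i'.+1 then step (i', s i') else (k, w0).
pose w i := (s i).2.
have sS i : [/\ ((s i).1 < (s i.+1).1)%N, atom D (s i).1 (w i) (w i.+1),
    exists2 m, (i <= m <= (s i.+1).1)%N &
      i%:R < mfun_at (set_val f) m (w i.+1) &
    exists2 m, (i <= m <= (s i.+1).1)%N &
      mfun_at (set_val f) m (w i.+1) < - i%:R].
  exact: stepP (i, s i).
have si i : (i <= (s i).1)%N.
  by elim: i => // i ih; have [lt _ _ _] := sS i; exact: leq_ltn_trans lt.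
have smono i l : (i <= l)%N -> ((s i).1 <= (s l).1)%N.
  elim: l => [|l ih]; first by rewrite leqn0 => /eqP->.
  rewrite leq_eqVlt => /orP[/eqP->//|/ih h]; have [lt _ _ _] := sS l.
  exact: leq_trans h (ltnW lt).
have nest i l : (i <= l)%N -> atom D (s i).1 (w i) (w l).
  elim: l => [|l ih]; first by rewrite leqn0 => /eqP->.
  rewrite leq_eqVlt ltnS => /orP[/eqP->//|il]; have [_ h _ _] := sS l.
  rewrite -(atom_eq (ih il)); exact: (atom_mono (smono _ _ il) h).
(* Since [n <= (s n).1], the points after [w n] remain in its block of level
   [n]; hence [w i] may replace [w n] as soon as [n <= (s i).1]. *)
pose Y n := atom D n (w n).
have YE n i : (n <= (s i).1)%N -> Y n = atom D n (w i).
  move=> ni; have [il|/ltnW li] := leqP i n.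
    by apply: atom_eq; apply: (atom_mono ni); exact: nest.
  by apply/esym/atom_eq; apply: (atom_mono (si n)); exact: nest.
have DY n : D n (Y n) by exact: atom_in.
have Yb : branches D (fun n => SigSub (mem_set (DY n))).
  move=> n m nm; suff: Y m `<=` Y n by [].
  rewrite (YE n m); last exact: leq_trans nm (si m).
  exact: atom_mono.
pose y : branches D := SigSub (mem_set Yb).
have yE n : branch_at y n = Y n by [].
have yw n i : (n <= (s i).1)%N -> branch_at y n (w i) by move=> /YE; rewrite yE => ->.
exists y; split=> [i|n nk].
  have [_ _ [m /andP[im mi] up] [m' /andP[im' mi'] dn]] := sS i.
  split; [exists m|exists m'] => //; rewrite (@value_atE _ _ _ (w i.+1))//; exact: yw.
rewrite yE (YE n 0%N nk); apply: atomE (Dx0 n) _.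
exact: (set_valP x0 n k nk).
Qed.

End filtration.

Theorem theorem4p3 (d : measure_display) (T : measurableType d) (R : realType)
    (P : probability T R) (Sigma D : nat -> set (set T))
    (hSigma : finite_filtration Sigma)
    (hD : generating_partitions Sigma D)
    (hpos : forall n B, D n B -> (0 < P B)%E)
    (hsplit : forall n B, D n B -> exists2 m, (n < m)%N & ~ D m B) :
  exists2 A : set (M11 P Sigma), comeager A &
    forall f : M11 P Sigma, A f ->
      M1s P Sigma (set_val f) /\
      let S : set (branches D) :=
        [set x | limn_esup (fun n => (value_at_branch (set_val f) x n)%:E)
                   = +oo%E /\
                 limn_einf (fun n => (value_at_branch (set_val f) x n)%:E)
                   = -oo%E] in
      dense S /\ Gdelta S.
Proof.
exists (\bigcap_j oscillating_concentrated D j).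
  exists (fun j => ~` oscillating_concentrated D j); last by rewrite setC_bigcap.
  by move=> j; exact: oscillating_concentratedC_nowhere_dense.
move=> f fA; have fW j : oscillating_concentrated D j f by exact: fA.
split; first by split; [exact: (set_valP f).1|exact: concentrated_cvg0 fW].
move=> S; have -> : S = [set x | forall i, oscillates_beyond (set_val f) x i].
  by apply/seteqP; split=> x /oscillates_beyondP.
by split; [exact: oscillates_beyond_dense fW|exact: oscillates_beyond_Gdelta].
Qed.
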